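(* Let $d\ge1$ be an integer, $s\ge q>1$, $b>0$ and $A>0$, and consider the loss $\ell(y,y')=|y-y'|^q$ with output space $\mathbb R$. For any training set size $n\ge1$ and input space $\mathcal X$ containing at least $\lfloor\log_2(2d)\rfloor$ points, there exists a set $\mathcal G$ of $d$ prediction functions uniformly bounded by $b$ such that: for any estimator $\hat g$ there exists a probability distribution on the data space $\mathcal X\times\mathbb R$ for which $\mathbb E|Y|^s\le A$ and both of the following inequalities hold: $$\mathbb ER(\hat g)-\min_{g\in\mathcal G}R(g)\ge C\Big(\frac{\log|\mathcal G|}n\wedge1\Big)^{1-\frac{q-1}s},\qquad \mathbb ER(\hat g)-\min_{g\in\mathcal G}R(g)\ge C\Big(\frac{\log|\mathcal G|}n\wedge1\Big)^{1-\frac q{s+2}},$$ for a quantity $C>0$ which depends only on the real numbers $b$, $A$, $q$ and $s$.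
   Context: A prediction function is a measurable map $\mathcal X\to\mathbb R$. For a distribution $P$ on $\mathcal X\times\mathbb R$, $R(g)=\mathbb E_{(X,Y)\sim P}\ell[Y,g(X)]$. An estimator maps a training set $Z_1^n\in(\mathcal X\times\mathbb R)^n$ to a prediction function (measurably), and $\mathbb ER(\hat g)$ is its expected risk when $Z_1^n\sim P^{\otimes n}$. $a\wedge b=\min(a,b)$ and $\lfloor x\rfloor$ is the largest integer $k\le x$.
   Formalization: The ⌊log₂(2d)⌋ points of the input space are required to be pairwise separated by measurable sets (just distinctness when singletons are measurable); otherwise, e.g. for the trivial σ-algebra, all prediction functions are constant and the bound fails. *)

(* Defs.v *)
From HB Require Import structures.
From mathcomp Require Import all_boot all_order all_algebra finmap.
From mathcomp Require Import all_classical all_reals all_analysis.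

Set Implicit Arguments.
Unset Strict Implicit.
Unset Printing Implicit Defensive.

Import Order.TTheory GRing.Theory Num.Theory.
Import numFieldNormedType.Exports.

Local Open Scope classical_set_scope.
Local Open Scope ring_scope.

(* Points of X that measurable functions can tell apart. On a measurable space
   whose singletons are measurable this just says that the points are distinct
   (measurably_separatedE); on a coarser sigma-algebra, points lying in the same
   measurable sets count as one, since every prediction function identifies
   them. *)
Definition measurably_separated (d : measure_display) (X : measurableType d)
    (I : eqType) (x : I -> X) : Prop :=
  forall i j, i != j -> exists2 B, measurable B & B (x i) /\ ~ B (x j).

Lemma measurably_separatedE (d : measure_display) (X : measurableType d)
    (I : eqType) (x : I -> X) :
  (forall a : X, measurable [set a]) ->
  measurably_separated x <-> injective x.
Proof.
move=> mX; split=> [sepx i j xij|injx i j ij].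
  by apply/eqP/negPn/negP => /sepx[B _ [Bi]]; rewrite -xij.
exists [set x i] => //; split=> // /injx ji; by rewrite ji eqxx in ij.
Qed.

Section power_probability.
Context (d : measure_display) (T : measurableType d) (R : realType).

Definition tuple_consp n (z : T * n.-tuple T) : n.+1.-tuple T :=
  [tuple of z.1 :: z.2].

Lemma measurable_tuple_consp n : measurable_fun [set: T * n.-tuple T]
  (@tuple_consp n).
Proof. exact: measurable_cons. Qed.

HB.instance Definition _ n := isMeasurableFun.Build _ _ _ _
  (@tuple_consp n) (@measurable_tuple_consp n).

(* The n-fold product of P, i.e. the law of a sample of n independent points
   distributed according to P. *)
Fixpoint power_probability (P : probability T R) (n : nat) :
    probability (n.-tuple T) R :=
  match n with
  | 0%N => dirac [tuple]
  | n'.+1 => distribution (P \x power_probability P n')%E (@tuple_consp n')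
  end.

Lemma power_probability_box (P : probability T R) n (B : 'I_n -> set T) :
  (forall i, measurable (B i)) ->
  power_probability P n [set t | forall i, B i (tnth t i)] =
  (\prod_(i < n) P (B i))%E.
Proof.
elim: n B => [|n IHn] B mB /=.
  by rewrite big_ord0 diracE mem_set// => -[].
rewrite big_ord_recl -IHn; last by move=> i; exact: mB.
rewrite /distribution /pushforward /=.
have -> : @tuple_consp n @^-1` [set t | forall i, B i (tnth t i)] =
    B ord0 `*` [set t | forall i, B (lift ord0 i) (tnth t i)].
  apply/seteqP; split=> [[a t] /= Bt|[a t] [/= Ba Bt] i].
    split=> [|i]; first by have := Bt ord0; rewrite tnth0.
    by have := Bt (lift ord0 i); rewrite tnthS.
  by case: (unliftP ord0 i) => [j ->|->]; rewrite ?tnthS ?tnth0.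
rewrite product_measure1E//.
rewrite (_ : [set t | _] =
    \bigcap_i (@tnth n T ^~ i @^-1` B (lift ord0 i))); last first.
  by apply/seteqP; split=> t Bt i => [_|]; exact: Bt.
apply: fin_bigcap_measurable => // i _.
by rewrite -[X in measurable X]setTI; apply: measurable_tnth.
Qed.

End power_probability.

Section learning.
Context (R : realType) (d : measure_display) (X : measurableType d).
Local Open Scope ereal_scope.

Definition power_loss (q : R) (y y' : R) : R := `|y - y'|%R `^ q.

Definition risk (loss : R -> R -> R) (P : probability (X * R)%type R)
  (g : X -> R) : \bar R := 'E_P[fun z => loss z.2 (g z.1)].

(* An estimator is given in uncurried form: measurability in the training set
   and in the input are required jointly. *)
Definition estimator (n : nat) : Type := {mfun (n.-tuple (X * R) * X)%type >-> R}.

Definition expected_risk (loss : R -> R -> R) (P : probability (X * R)%type R)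
    (n : nat) (ghat : estimator n) : \bar R :=
  \int[power_probability P n]_Z risk loss P (fun x => ghat (Z, x)).

Definition min_risk (loss : R -> R -> R) (P : probability (X * R)%type R)
    (G : {fset {mfun X >-> R}}) : \bar R :=
  \big[mine/+oo]_(g <- G) risk loss P g.

End learning.

(* Main.v *)
Require Import Defs.
From mathcomp Require Import all_boot all_order all_algebra finmap.
From mathcomp Require Import all_classical all_reals all_analysis.
From mathcomp Require Import measurable_realfun ring lra.
Import Order.TTheory GRing.Theory Num.Theory.
Import numFieldNormedType.Exports.
Local Open Scope ring_scope.

(** Assouad's method. Put mass [w / k], with [k] about [log2 d], on each of [k]
    points and the rest on one more point where the label is known, and let a
    hidden sign at each of the [k] points choose between two laws of the label,
    both supported by the same two values. [G] contains the [2 ^ k] Bayes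
    predictors. If [h] is the Hellinger deficit between the two laws and
    [n * w * h / k] is small, then no estimator identifies the signs, and it
    loses a constant fraction of [w * D], where [D] is the least sum of the two
    excess risks that a single prediction can have.
    With [t = min (log d / n) 1], the exponent [1 - (q - 1) / s] comes from
    labels in [{0, B}], where [B = t ^ (- 1 / s)] has probability either [0] or
    about [B ^ (1 - q)], and the exponent [1 - q / (s + 2)] from labels in
    [{B, - B}], where [B = t ^ (- 1 / (s + 2))] and the bias of the sign is of
    order [1 / B]. As [t <= 1], the construction with the smaller exponent gives
    both inequalities. *)

(** * Finitely supported probabilities *)

(** Later arguments see the measure only through this integral formula, which turns risks, moments
    and expectations over samples into finite sums. Repetitions among the points [a i] are
    harmless. *)
Lemma discrete_measure (R : realType) (d : measure_display)
    (T : measurableType d) (I : eqType) (s : seq I) (p : I -> R) (a : I -> T) :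
  (forall i, 0 <= p i) ->
  exists m : {measure set T -> \bar R}, forall f : T -> \bar R,
    (forall x, 0%E <= f x)%E -> measurable_fun setT f ->
    (\int[m]_x f x = \sum_(i <- s) (p i)%:E * f (a i))%E.
Proof.
move=> p0; elim: s => [|i s [m IHm]].
  exists mzero => f f0 mf; rewrite big_nil.
  by rewrite integral_measure_zero.
exists (measure_add (mscale (NngNum (p0 i)) (dirac (a i))) m) => f f0 mf.
rewrite ge0_integral_measure_add// IHm// big_cons; congr (_ + _)%E.
by rewrite ge0_integral_mscale// integral_dirac// diracT mul1e.
Qed.

Lemma discrete_probability (R : realType) (d : measure_display)
    (T : measurableType d) (I : finType) (p : I -> R) (a : I -> T) :
  (forall i, 0 <= p i) -> \sum_i p i = 1 ->
  exists P : probability T R, forall f : T -> \bar R,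
    (forall x, 0%E <= f x)%E -> measurable_fun setT f ->
    (\int[P]_x f x = \sum_i (p i)%:E * f (a i))%E.
Proof.
move=> p0 p1.
have [m mE] := @discrete_measure R d T I (index_enum I) p a p0.
have m1 : m setT = 1%E.
  rewrite -[LHS]mul1e -integral_cst// mE//.
  under eq_bigr do rewrite mule1.
  by rewrite sumEFin p1.
have [i0 _|I0] := pickP I; last first.
  by move: p1; rewrite big_pred0// => /eqP; rewrite eq_sym oner_eq0.
(* The mass of [m] is one already, so normalizing leaves its values alone and supplies the structure
   of a probability. *)
exists (mnormalize m (dirac (a i0))) => f f0 mf; rewrite -mE//.
apply: eq_measure_integral => A mA _.
by rewrite /= /mnormalize m1 onee_eq0/= invr1 mule1.
Qed.

Lemma sum_tuple_cons (R : Type) (zero : R) (op : Monoid.com_law zero)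
    (I : finType) (n : nat) (F : n.+1.-tuple I -> R) :
  \big[op/zero]_(t : n.+1.-tuple I) F t =
    \big[op/zero]_(i : I) \big[op/zero]_(t : n.-tuple I) F [tuple of i :: t].
Proof.
rewrite pair_big/= (reindex (fun u : I * n.-tuple I => [tuple of u.1 :: u.2]))//.
exists (fun t : n.+1.-tuple I => (thead t, [tuple of behead t])).
  by move=> [i t] _; congr pair; apply/val_inj.
by move=> t _; apply/val_inj; rewrite /= [in RHS](tuple_eta t).
Qed.

(** Tonelli peels off the first observation. Samples become tuples over the finite type [I], so that
    laws with the same points and different weights can be compared tuple by tuple. *)
Lemma integral_power_probability (R : realType) (d : measure_display)
    (T : measurableType d) (I : finType) (p : I -> R) (a : I -> T)
    (P : probability T R) :
  (forall i, 0 <= p i) ->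
  (forall f : T -> \bar R, (forall x, 0%E <= f x)%E -> measurable_fun setT f ->
    (\int[P]_x f x = \sum_i (p i)%:E * f (a i))%E) ->
  forall (n : nat) (f : n.-tuple T -> \bar R),
    (forall x, 0%E <= f x)%E -> measurable_fun setT f ->
    (\int[power_probability P n]_x f x
      = \sum_(t : n.-tuple I) (\prod_(i <- t) p i)%:E * f (map_tuple a t))%E.
Proof.
move=> p0 PE; elim=> [|n IHn] f f0 mf.
  rewrite /= integral_dirac// diracT mul1e.
  rewrite (bigD1 [tuple])//= big_nil mul1e big1 ?adde0//.
    by congr f; apply/val_inj.
  by move=> t; rewrite tuple0.
rewrite [power_probability _ _]/= ge0_integral_distribution//.
have mfc : measurable_fun setT (f \o @tuple_consp _ T n).
  by apply: measurableT_comp => //; exact: measurable_tuple_consp.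
have fc0 z : (0%E <= (f \o @tuple_consp _ T n) z)%E by exact: f0.
rewrite fubini_tonelli1// PE; first last.
- exact: measurable_fun_fubini_tonelli_F.
- by move=> x; apply: integral_ge0.
rewrite sum_tuple_cons; apply: eq_bigr => i _.
rewrite /fubini_F IHn//; last exact: measurableT_comp.
rewrite ge0_sume_distrr//; last first.
  by move=> t _; apply: mule_ge0 => //; rewrite lee_fin prodr_ge0.
apply: eq_bigr => t _; rewrite muleA -EFinM big_cons/=; congr (_ * f _)%E.
exact/val_inj.
Qed.

(** * Assouad's lemma *)

(** Serves twice: for the weights it gives total mass one, and for [Num.sqrt (p a * q a)] it says
    that the affinity of product laws is the power of the affinity. *)
Lemma sum_tuple_prod (R : comNzRingType) (I : finType) (r : I -> R) (n : nat) :
  \sum_(t : n.-tuple I) \prod_(i <- t) r i = (\sum_i r i) ^+ n.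
Proof.
elim: n => [|n IHn].
  by rewrite (bigD1 [tuple])//= big_nil big1 ?addr0// => t; rewrite tuple0.
rewrite sum_tuple_cons exprS -IHn mulr_suml; apply: eq_bigr => i _.
by rewrite mulr_sumr; apply: eq_bigr => t _; rewrite big_cons.
Qed.

(* This replaces the Cauchy-Schwarz bound of the total variation by the
   Hellinger affinity, and unlike it can be summed termwise. *)
Lemma geometric_mean_le (R : realFieldType) (p q r : R) :
  0 <= p -> 0 <= q -> 0 <= r -> r ^+ 2 = p * q ->
  r <= Num.min p q + (p + q) / 4.
Proof.
wlog pq : p q / p <= q.
  move=> H p0 q0 r0 rE; have [pq|/ltW qp] := leP p q.
    by have := H _ _ pq p0 q0 r0 rE; rewrite min_l.
  by have := H _ _ qp q0 p0 r0; rewrite min_l// [q * p]mulrC [q + p]addrC; apply.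
move=> p0 q0 r0 rE; rewrite min_l//.
have : r <= p + q / 4.
  rewrite -(@ler_pXn2r _ 2) ?nnegrE//; last by lra.
  rewrite rE -subr_ge0 (_ : _ - _ = (p - q / 4) ^+ 2) ?sqr_ge0//.
  by field.
lra.
Qed.

(** Le Cam's two-point argument: each tuple contributes at least [D] times the smaller of its two
    likelihoods. By [geometric_mean_le] these smaller likelihoods sum to at least the [n]-th power
    of the affinity minus 1 / 2, hence to at least 1 / 4. *)
Lemma two_point_bound (R : realType) (I : finType) (n : nat) (p q : I -> R)
    (e f : n.-tuple I -> R) (D : R) :
  (forall a, 0 <= p a) -> \sum_a p a = 1 ->
  (forall a, 0 <= q a) -> \sum_a q a = 1 ->
  3 / 4 <= (\sum_a Num.sqrt (p a * q a)) ^+ n ->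
  0 <= D -> (forall t, 0 <= e t) -> (forall t, 0 <= f t) ->
  (forall t, D <= e t + f t) ->
  D / 4 <= \sum_(t : n.-tuple I) (\prod_(a <- t) p a) * e t +
    \sum_(t : n.-tuple I) (\prod_(a <- t) q a) * f t.
Proof.
move=> p0 p1 q0 q1 aff D0 e0 f0 ef.
pose P (t : n.-tuple I) := \prod_(a <- t) p a.
pose Q (t : n.-tuple I) := \prod_(a <- t) q a.
pose S (t : n.-tuple I) := \prod_(a <- t) Num.sqrt (p a * q a).
have le_term t : (S t - (P t + Q t) / 4) * D <= P t * e t + Q t * f t.
  have P0 : 0 <= P t by exact: prodr_ge0.
  have Q0 : 0 <= Q t by exact: prodr_ge0.
  have S0 : 0 <= S t by apply: prodr_ge0 => a _; exact: sqrtr_ge0.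
  have SE : S t ^+ 2 = P t * Q t.
    rewrite /S -prodrXl -big_split; apply: eq_bigr => a _.
    by rewrite sqr_sqrtr// mulr_ge0.
  have := geometric_mean_le _ _ _ _ P0 Q0 S0 SE.
  rewrite -lerBlDr => /(ler_wpM2r D0)/le_trans; apply.
  have := e0 t; have := f0 t; have := ef t.
  by case: (leP (P t) (Q t)) => PQ; nra.
rewrite -big_split/=; apply: le_trans (ler_sum _ (fun t _ => le_term t)).
rewrite -mulr_suml sumrB -mulr_suml big_split/= !sum_tuple_prod p1 q1 expr1n.
by nra.
Qed.

Definition flip {k : nat} (i : 'I_k) (s : {ffun 'I_k -> bool}) :
    {ffun 'I_k -> bool} :=
  [ffun j => if j == i then ~~ s j else s j].

Lemma flipK (k : nat) (i : 'I_k) : involutive (flip i).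
Proof.
by move=> s; apply/ffunP => j; rewrite !ffunE; case: eqP => // _; rewrite negbK.
Qed.

(** For each coordinate [i], the sign vectors [s] and [flip i s] form a two-point problem. Averaging
    over the cube adds up the [k] bounds, and the worst [s] does at least as badly as the
    average. *)
Lemma assouad (R : realType) (I : finType) (n k : nat)
    (p : {ffun 'I_k -> bool} -> I -> R) (e : bool -> 'I_k -> n.-tuple I -> R)
    (D : R) :
  (forall s a, 0 <= p s a) -> (forall s, \sum_a p s a = 1) ->
  (forall s i, 3 / 4 <= (\sum_a Num.sqrt (p s a * p (flip i s) a)) ^+ n) ->
  0 <= D -> (forall b i t, 0 <= e b i t) ->
  (forall i t, D <= e true i t + e false i t) ->
  exists s, D * k%:R / 8 <=
    \sum_(t : n.-tuple I) (\prod_(a <- t) p s a) * \sum_i e (s i) i t.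
Proof.
move=> p0 p1 aff D0 e0 eD.
pose H s i := \sum_(t : n.-tuple I) (\prod_(a <- t) p s a) * e (s i) i t.
pose s0 : {ffun 'I_k -> bool} := [ffun=> true].
case: (@arg_maxP _ _ _ s0 xpredT (fun s => \sum_i H s i)) => // s _ smax.
exists s.
rewrite (_ : \sum_t _ = \sum_i H s i); last first.
  under eq_bigr do rewrite mulr_sumr.
  by rewrite exchange_big.
(* As [flip i] permutes the cube, summing the two-point bounds over [s'] counts every term twice,
   which turns [D / 4] into [D / 8]. *)
have pair_le i : \sum_(s' : {ffun 'I_k -> bool}) D / 8 <= \sum_s' H s' i.
  have : \sum_(s' : {ffun 'I_k -> bool}) D / 4 <=
      \sum_s' (H s' i + H (flip i s') i).
    apply: ler_sum => s' _; apply: two_point_bound => // t.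
    rewrite ffunE eqxx; case: (s' i) => /=; first exact: eD.
    by rewrite addrC; exact: eD.
  rewrite big_split/= [X in _ + X](_ : _ = \sum_s' H s' i).
    rewrite !sumr_const -(mulr_natr (D / 4)) -(mulr_natr (D / 8)).
    move: (#|_|%:R) (\sum_s' _) => N x; lra.
  by rewrite [RHS](reindex_inj (inv_inj (@flipK k i))).
have card_gt0 : 0 < #|{ffun 'I_k -> bool}|%:R :> R.
  by rewrite ltr0n; apply/card_gt0P; exists s0.
rewrite -(ler_pM2r card_gt0).
have /(le_trans _) : \sum_s' \sum_i H s' i <=
    (\sum_i H s i) * #|{ffun 'I_k -> bool}|%:R.
  by rewrite mulr_natr -sumr_const; apply: ler_sum => s' _; exact: smax.
apply.
rewrite exchange_big/=; apply: le_trans (ler_sum _ (fun i _ => pair_le i)).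
rewrite !sumr_const card_ord -(mulr_natr (_ *+ _)) -(mulr_natr (D / 8)).
by move: (#|_|%:R) (k%:R) => N K; lra.
Qed.

(** * Label laws that are hard to tell apart *)

(** Young's inequality for [|x|] and the power [q - 1] of [a], with conjugate exponents [q] and
    [q / (q - 1)], yields the tangent at [a] to a convex function. *)
Lemma powR_tangent (R : realType) (q a x : R) : 1 < q -> 0 <= a ->
  a `^ q + q * a `^ (q - 1) * (x - a) <= `|x| `^ q.
Proof.
move=> q1 a0.
have q0 : 0 < q by lra.
have qB0 : 0 < q - 1 by lra.
have /= := @conjugate_powR R `|x| (a `^ (q - 1)) q (q / (q - 1)) (normr_ge0 _)
  (powR_ge0 _ _) q0 (divr_gt0 q0 qB0).
have -> : q^-1 + (q / (q - 1))^-1 = 1 by rewrite invf_div; field; lra.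
move=> /(_ erefl).
rewrite -powRrM [(q - 1) * _]mulrC divfK; last by rewrite gt_eqF.
rewrite invf_div => young.
have young' : q * (`|x| * a `^ (q - 1)) <= `|x| `^ q + (q - 1) * a `^ q.
  have := ler_wpM2l (ltW q0) young.
  rewrite [X in _ <= X](_ : _ = `|x| `^ q + (q - 1) * a `^ q)//.
  by field; lra.
have aE := mulr_powRB1 a0 q0.
have xa : x * a `^ (q - 1) <= `|x| * a `^ (q - 1).
  by rewrite ler_wpM2r ?powR_ge0 ?ler_norm.
have := ler_wpM2l (ltW q0) xa.
rewrite -aE in young' *; lra.
Qed.

(** The equation assumed is the stationarity of [m]: in the weighted sum of the tangent inequalities
    at the two labels, the terms in [y] cancel. *)
Lemma two_label_min (R : realType) (q u v l r m y : R) : 1 < q ->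
  0 <= u -> 0 <= v -> l <= m -> m <= r ->
  u * (r - m) `^ (q - 1) = v * (m - l) `^ (q - 1) ->
  u * (r - m) `^ q + v * (m - l) `^ q <= u * `|r - y| `^ q + v * `|l - y| `^ q.
Proof.
move=> q1 u0 v0 lm mr uv.
have rm0 : 0 <= r - m by rewrite subr_ge0.
have ml0 : 0 <= m - l by rewrite subr_ge0.
have := ler_wpM2l u0 (@powR_tangent R q (r - m) (r - y) q1 rm0).
have := ler_wpM2l v0 (@powR_tangent R q (m - l) (y - l) q1 ml0).
have := congr1 (fun z => z * (q * (m - y))) uv.
rewrite (distrC y l); lra.
Qed.

Lemma bernoulli_ge (R : realType) (r v : R) : 1 <= r -> v <= 1 ->
  1 - r * v <= (1 - v) `^ r.
Proof.
rewrite le_eqVlt => /predU1P[<- v1|r1 v1]; first by rewrite powRr1; lra.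
have := @powR_tangent R r 1 (1 - v) r1 ler01.
by rewrite !powR1 ger0_norm; lra.
Qed.

(** For [r < 1], take Bernoulli's inequality with exponent [r^-1] at [r * v] and raise it to the
    power [r]. *)
Lemma bernoulli_le (R : realType) (r v : R) : 0 < r -> 0 <= v -> v < 1 ->
  (1 - v) `^ r <= 1 - Num.min 1 r * v.
Proof.
move=> r0 v0 v1; have [r1|r1] := leP 1 r.
  by rewrite mul1r ge1r_powR//; lra.
have := @bernoulli_ge R r^-1 (r * v); rewrite mulKf ?gt_eqF// invf_ge1// => H.
have rv : r * v <= 1 by nra.
have /(ge0_ler_powR (ltW r0)) : 1 - v <= (1 - r * v) `^ r^-1.
  by apply: H => //; exact: ltW.
rewrite -powRrM mulVf ?gt_eqF// powRr1 ?nnegrE; last by lra.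
by apply; [lra|exact: powR_ge0].
Qed.

Lemma powR_deficit (R : realType) (r v : R) : 0 < r -> 0 <= v -> v < 1 ->
  1 - (1 - v) `^ r <= Num.max 1 r * v.
Proof.
move=> r0 v0 v1; have [r1|r1] := leP r 1.
  by have := @ger1_powR R (1 - v) r; lra.
by have := @bernoulli_ge R r v (ltW r1) (ltW v1); lra.
Qed.

Definition label_risk {R : realType} (q : R) (Q : bool -> bool -> R)
    (v : bool -> R) (b : bool) (y : R) : R :=
  \sum_e Q b e * `|v e - y| `^ q.

(* [Q b] is the law on the label values [v true], [v false] under the sign [b],
   and [c b] is its Bayes prediction. *)
Record hard_labels {R : realType} (q : R) (Q : bool -> bool -> R)
    (v c : bool -> R) (h D : R) : Prop := HardLabels {
  hard_ge0 : forall b e, 0 <= Q b e;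
  hard_sum : forall b, \sum_e Q b e = 1;
  hard_min : forall b y, label_risk q Q v b (c b) <= label_risk q Q v b y;
  hard_excess : forall y,
    label_risk q Q v true (c true) + label_risk q Q v false (c false) + D <=
    label_risk q Q v true y + label_risk q Q v false y;
  hard_affinity : 1 - h <= \sum_e Num.sqrt (Q true e * Q false e) }.

Lemma sqrt_ge_id (R : rcfType) (x : R) : 0 <= x <= 1 -> x <= Num.sqrt x.
Proof.
move=> /andP[x0 x1]; rewrite -{1}(ger0_norm x0) -sqrtr_sqr ler_wsqrtr// expr2.
by rewrite ler_piMl.
Qed.

(** The probability [p] of the large label is the one that makes [e] stationary, and it is at most 1
    / 2. The affinity is the square root of [1 - p], hence at least [1 - p]. *)
Lemma rare_labels (R : realType) (q B e p : R) : 1 < q -> 0 < e -> e <= 2^-1 ->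
  1 <= B -> p = e `^ (q - 1) / ((B - e) `^ (q - 1) + e `^ (q - 1)) ->
  hard_labels q
    (fun b y => if b then if y then p else 1 - p else if y then 0 else 1)
    (fun y => if y then B else 0) (fun b => if b then e else 0)
    p (e `^ q / 2 * ((q - 1) * (1 - 2^-1 `^ (q - 1)^-1))).
Proof.
move=> q1 e0 e2 B1 pE.
have q0 : 0 < q by lra.
have qB0 : 0 < q - 1 by lra.
have Be0 : 0 <= B - e by lra.
set a := e `^ (q - 1) in pE *; set a' := (B - e) `^ (q - 1) in pE.
have a0 : 0 < a by exact: powR_gt0.
have aa' : a <= a' by apply: ge0_ler_powR; rewrite ?nnegrE; lra.
have p0 : 0 <= p by rewrite pE divr_ge0; lra.
have p2 : p <= 2^-1 by rewrite pE ler_pdivrMr; lra.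
have balance : p * a' = (1 - p) * a by rewrite pE; field; rewrite gt_eqF; lra.
have min_e y : p * (B - e) `^ q + (1 - p) * e `^ q <=
    p * `|B - y| `^ q + (1 - p) * `|0 - y| `^ q.
  have := @two_label_min R q p (1 - p) 0 B e y q1 p0.
  by rewrite subr0 -/a -/a'; apply=> //; lra.
split => [[] []|[]|[] y|y|]; rewrite ?/label_risk ?big_bool//=; try lra.
- by rewrite (ger0_norm Be0) sub0r normrN gtr0_norm.
- by rewrite !subr0 !mul0r !mul1r normr0 powR0 ?gt_eqF// !add0r powR_ge0.
- rewrite !subr0 !sub0r !normrN !mul0r !mul1r normr0 powR0 ?gt_eqF// !add0r.
  rewrite (ger0_norm Be0) (gtr0_norm e0).
  (* At [m * e] the tangent to the loss has half of its slope at [e]. The two laws together give the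
     label 0 a weight of at least [2 * (1 - p)], so combining this tangent with the one at [B - e]
     eliminates [y]. *)
  set m := 2^-1 `^ _.
  have m0 : 0 <= m by exact: powR_ge0.
  have mq : m `^ (q - 1) = 2^-1.
    by rewrite /m -powRrM mulVf ?gt_eqF// powRr1// invr_ge0.
  have eE := mulr_powRB1 (ltW e0) q0.
  have := @powR_tangent R q (B - e) (B - y) q1 Be0.
  have := @powR_tangent R q (m * e) y q1 (mulr_ge0 m0 (ltW e0)).
  rewrite -(mulr_powRB1 (mulr_ge0 m0 (ltW e0)) q0) !powRM ?(ltW e0)// mq.
  rewrite -/a -/a' -eE -/a => low high.
  have := ler_wpM2l p0 high.
  have Y0 := powR_ge0 `|y| q.
  move: balance; set X := `|B - y| `^ q; set Y := `|y| `^ q in low Y0 *.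
  set Z := (B - e) `^ q => balance high'.
  have balance' : p * (q * a' * (B - y - (B - e))) = (1 - p) * a * (q * (e - y)).
    by rewrite -balance; ring.
  rewrite mulrDr balance' in high'.
  have m1 : m <= 1.
    rewrite (_ : 1 = 1 `^ (q - 1)^-1); last by rewrite powR1.
    by apply: ge0_ler_powR; rewrite ?invr_ge0 ?nnegrE; lra.
  have K0 : 0 <= (q - 1) * (1 - m) * (e * a).
    by rewrite !mulr_ge0 ?subr_ge0 ?(ltW e0) ?(ltW a0)//; lra.
  have : (1 - p) * ((q - 1) * (1 - m) * (e * a)) <=
      (1 - p) * (2 * Y + (q - 1) * (e * a) - q * a * y).
    by rewrite ler_wpM2l//; lra.
  have : 2^-1 * ((q - 1) * (1 - m) * (e * a)) <=
      (1 - p) * ((q - 1) * (1 - m) * (e * a)).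
    by rewrite ler_wpM2r//; lra.
  have : 0 <= p * Y by rewrite mulr_ge0.
  lra.
- rewrite mulr0 sqrtr0 add0r mulr1; apply: sqrt_ge_id; lra.
Qed.

(** Without the second term of the denominator, the quotient is the power [q - 1] of [e / (B - e)],
    which is at most [1 / B] because [e <= 1 / 2] and [B >= 1]. *)
Lemma rare_labels_prob (R : realType) (q B e : R) : 1 < q -> 0 < e -> e <= 2^-1 ->
  1 <= B ->
  e `^ (q - 1) / ((B - e) `^ (q - 1) + e `^ (q - 1)) <= B `^ (1 - q).
Proof.
move=> q1 e0 e2 B1.
have B0 : 0 < B by lra.
have a0 : 0 < e `^ (q - 1) by exact: powR_gt0.
have a'0 := powR_ge0 (B - e) (q - 1).
rewrite ler_pdivrMr; last by lra.
apply: (@le_trans _ _ (B `^ (1 - q) * (B - e) `^ (q - 1))); last first.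
  by rewrite ler_wpM2l ?powR_ge0//; lra.
rewrite (_ : 1 - q = -1 * (q - 1)); last by rewrite mulN1r opprB.
rewrite powRrM powR_inv1; last exact: ltW.
rewrite -powRM ?invr_ge0 ?(ltW B0)//; last by lra.
apply: ge0_ler_powR; rewrite ?nnegrE; try lra.
  by rewrite mulr_ge0 ?invr_ge0 ?(ltW B0)//; lra.
by rewrite mulrC ler_pdivlMr//; nra.
Qed.

(** Weights in the ratio of [a] to [a'] make [c] and [- c] stationary. Each Bayes risk is [B] times
    the harmonic mean of [a] and [a'], while the best shared prediction is 0. The gap comes from
    bounding the harmonic mean by the geometric one. *)
Lemma balanced_labels (R : realType) (q B c : R) : 1 < q -> 0 < c -> c < B ->
  let a := (B + c) `^ (q - 1) in let a' := (B - c) `^ (q - 1) in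
  hard_labels q
    (fun b y => (if b == y then a else a') / (a + a'))
    (fun y => if y then B else - B) (fun b => if b then c else - c)
    ((Num.max 1 (q - 1) * (2 * c / B)) ^+ 2)
    (2 * (B `^ q * (Num.min 1 ((q - 1) / 2) * (c / B) ^+ 2))).
Proof.
move=> q1 c0 cB a a'.
have q0 : 0 < q by lra.
have qB0 : 0 < q - 1 by lra.
have B0 : 0 < B by lra.
have Bc0 : 0 < B - c by lra.
have Bc0' : 0 < B + c by lra.
have a'0 : 0 < a' by exact: powR_gt0.
have a0 : 0 < a by exact: powR_gt0.
have a'a : a' <= a by apply: ge0_ler_powR; rewrite ?nnegrE; lra.
have s0 : 0 < a + a' by lra.
have u0 : 0 <= a / (a + a') by rewrite divr_ge0; lra.
have v0 : 0 <= a' / (a + a') by rewrite divr_ge0; lra.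
have uv1 : a / (a + a') + a' / (a + a') = 1 by field; rewrite gt_eqF.
have BcE : (B - c) * a' = (B - c) `^ q by exact: mulr_powRB1 (ltW Bc0) q0.
have BcE' : (B + c) * a = (B + c) `^ q by exact: mulr_powRB1 (ltW Bc0') q0.
have normE : (`|B - c| = B - c) * (`|- B - c| = B + c) * (`|B - - c| = B + c)
    * (`|- B - - c| = B - c).
  by rewrite -!opprD !normrN opprK !gtr0_norm.
split => [[] []|[]|[] y|y|]; rewrite ?/label_risk ?big_bool//=; try lra.
- rewrite !normE.
  have := @two_label_min R q (a / (a + a')) (a' / (a + a')) (- B) B c y q1 u0 v0.
  rewrite opprK [c + B]addrC; apply; try lra.
  by rewrite -/a -/a'; ring.
- rewrite !normE.
  have := @two_label_min R q (a' / (a + a')) (a / (a + a')) (- B) B (- c) y q1 v0 u0.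
  rewrite !opprK [- c + B]addrC; apply; try lra.
  by rewrite -/a -/a'; ring.
- rewrite !normE -BcE -BcE'.
  have := @powR_tangent R q B (B - y) q1 (ltW B0).
  have := @powR_tangent R q B (B + y) q1 (ltW B0).
  rewrite -(normrN (B + y)) opprD.
  set X := `|B - y| `^ q; set Y := `|- B - y| `^ q => XB YB.
  (* With [b] below, [b * g] is the geometric mean of [a] and [a'], in a form to which
     [bernoulli_le] applies. *)
  pose g := (1 - (c / B) ^+ 2) `^ ((q - 1) / 2).
  have cB0 : 0 <= (c / B) by rewrite divr_ge0; lra.
  have cB1 : c / B < 1 by rewrite ltr_pdivrMr// mul1r.
  have cB2 : (c / B) ^+ 2 < 1 by rewrite expr_lt1.
  have gle : g <= 1 - Num.min 1 ((q - 1) / 2) * (c / B) ^+ 2.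
    by apply: bernoulli_le => //; [lra|exact: sqr_ge0].
  have g0 : 0 <= g by exact: powR_ge0.
  pose b := B `^ (q - 1).
  have b0 : 0 < b by exact: powR_gt0.
  have bE : B `^ q = B * b by rewrite mulr_powRB1// ltW.
  have abE : a * a' = (b * g) ^+ 2.
    rewrite exprMn -(powR_mulrn 2 g0) /g -powRrM divfK ?pnatr_eq0//.
    rewrite -(powR_mulrn 2 (ltW b0)) /b powRAC /a /a'.
    rewrite -powRM ?(ltW Bc0) ?(ltW Bc0')//.
    rewrite -powRM ?powR_ge0 ?subr_ge0 ?(ltW cB2)//; congr (_ `^ _).
    by rewrite powR_mulrn; [field; rewrite gt_eqF|exact: ltW].
  have amgm : 2 * (a * a') / (a + a') <= b * g.
    rewrite ler_pdivrMr// abE.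
    have : 2 * (b * g) <= a + a'.
      rewrite -(@ler_pXn2r _ 2) ?nnegrE//; [|nra|lra].
      rewrite exprMn -abE; have := sqr_ge0 (a - a'); nra.
    have : 0 <= b * g by nra.
    nra.
  have -> : a / (a + a') * ((B - c) * a') + a' / (a + a') * ((B + c) * a)
     + (a' / (a + a') * ((B + c) * a) + a / (a + a') * ((B - c) * a')) =
     2 * (B * (2 * (a * a') / (a + a'))).
    by field; rewrite gt_eqF.
  have -> : a / (a + a') * X + a' / (a + a') * Y +
     (a' / (a + a') * X + a / (a + a') * Y) = X + Y.
    by field; rewrite gt_eqF.
  have := ler_wpM2l (ltW B0) amgm.
  have := ler_wpM2l (mulr_ge0 (ltW B0) (ltW b0)) gle.
  rewrite bE in XB YB *; lra.
(* [xi] is the bias of the sign. The affinity is the square root of [1 - xi ^+ 2], so its deficit is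
   quadratic in the bias; and [xi] is at most [1 - a' / a], where [a' / a] is the power [q - 1] of
   [1 - t]. *)
- pose xi := (a - a') / (a + a').
  pose t := 2 * c / (B + c).
  have t0 : 0 <= t by rewrite divr_ge0; lra.
  have tlt1 : t < 1 by rewrite ltr_pdivrMr; lra.
  have tE : 1 - t = (B - c) / (B + c) by rewrite /t; field; lra.
  have M1 : 1 <= Num.max 1 (q - 1) by rewrite le_max lexx.
  have tB : t <= 2 * c / B.
    by rewrite /t ler_wpM2l ?lef_pV2 ?posrE; lra.
  have xi_le : xi <= Num.max 1 (q - 1) * (2 * c / B).
    apply: (@le_trans _ _ (Num.max 1 (q - 1) * t)); last first.
      by rewrite ler_wpM2l//; lra.
    apply: le_trans (powR_deficit _ _ _ qB0 t0 tlt1).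
    rewrite tE powRM ?invr_ge0 ?(ltW Bc0) ?(ltW Bc0')//.
    rewrite -(powR_inv1 (ltW Bc0')) -powRrM mulN1r powRN.
    rewrite -/a -/a' /xi ler_pdivrMr// mulrBl mul1r.
    have -> : a' / a * (a + a') = a' + a' * a' / a by field; rewrite gt_eqF.
    have : a' * a' / a <= a' by rewrite ler_pdivrMr// ler_pM2l.
    lra.
  have xi0 : 0 <= xi by rewrite divr_ge0; lra.
  have xi1 : xi <= 1 by rewrite ler_pdivrMr; lra.
  have xi2 : xi ^+ 2 <= (Num.max 1 (q - 1) * (2 * c / B)) ^+ 2.
    by apply: lerXn2r => //; rewrite nnegrE (le_trans xi0 xi_le).
  have xi21 : 0 <= 1 - xi ^+ 2 <= 1.
    by have := sqr_ge0 xi; have := exprn_ile1 2 xi0 xi1; lra.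
  have root : 1 - xi ^+ 2 = 4 * (a / (a + a') * (a' / (a + a'))).
    by rewrite /xi; field; rewrite gt_eqF.
  have := sqrt_ge_id _ _ xi21.
  rewrite {2}root sqrtrM// (_ : 4 = 2 ^+ 2); last by ring.
  rewrite sqrtr_sqr ger0_norm// [a' / _ * _]mulrC; lra.
Qed.

(** * The hypercube *)

(** Intersecting over [j] sets that contain [x i] but not [x j] isolates [x i] among the chosen
    points, even where singletons are not measurable. *)
Lemma separating_sets (k : nat) (disp : measure_display)
    (X : measurableType disp) (x : 'I_k.+1 -> X) : measurably_separated x ->
  exists D : 'I_k.+1 -> set X, (forall i, measurable (D i)) /\
    forall i j, D i (x j) <-> i = j.
Proof.
move=> sepx.
have /choice[D HD] i : exists Di : set X,
    measurable Di /\ forall j, Di (x j) <-> i = j.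
  have /choice[E HE] j : exists E : set X,
      measurable E /\ E (x i) /\ (j != i -> ~ E (x j)).
    have [->|ji] := eqVneq j i; first by exists setT.
    have [E mE [Ei Ej]] : exists2 E, measurable E & E (x i) /\ ~ E (x j).
      by apply: sepx; rewrite eq_sym.
    by exists E.
  exists (\bigcap_(j in [set: 'I_k.+1]) E j)%classic; split.
    by apply: fin_bigcap_measurable => // j _; exact: (HE j).1.
  move=> j; split=> [Ex|<- l _]; last exact: (HE l).2.1.
  apply/eqP; apply: contrapT => /negP; rewrite eq_sym => ji.
  exact: (HE j).2.2 ji (Ex j Logic.I).
by exists D; split=> i; [exact: (HD i).1|exact: (HD i).2].
Qed.

(** All [g s] agree at the spare point [x ord0], which will carry the mass left over by the
    hypercube; the other [k] points carry the signs. *)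
Lemma hypercube_class (R : realType) (k d : nat) (disp : measure_display)
    (X : measurableType disp) (x : 'I_k.+1 -> X) (b : R) (c : bool -> R) :
  measurably_separated x -> (2 ^ k <= d)%N -> 0 < b ->
  (forall e, `|c e| <= b) -> c false <= 0 -> c true != c false ->
  exists (G : {fset {mfun X >-> R}}) (g : {ffun 'I_k -> bool} -> {mfun X >-> R}),
    [/\ #|` G|%fset = d, forall f, f \in G -> forall a, `|f a| <= b,
      forall s, g s \in G, forall s, g s (x ord0) = c false
    & forall s i, g s (x (lift ord0 i)) = c (s i)].
Proof.
move=> sepx kd b0 cb c0 c1.
have [D [mD Dx]] := separating_sets _ _ _ _ sepx.
pose U (s : {ffun 'I_k -> bool}) : set X :=
  (\bigcup_(i in [set i | s i]) D (lift ord0 i))%classic.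
have mU s : measurable (U s).
  by apply: fin_bigcup_measurable => [|i _]; [exact: finite_finset|exact: mD].
have mg s : (fun a => c false + (c true - c false) * \1_(U s) a) \in
    (@mfun _ _ X R).
  by rewrite inE /=; apply: measurable_funD => //; apply: measurable_funM => //.
pose g s : {mfun X >-> R} := mfun_Sub (mg s).
have gE s a : g s a = c false + (c true - c false) * \1_(U s) a by [].
have g0 s : g s (x ord0) = c false.
  rewrite gE indicE memNset ?mulr0 ?addr0// => -[i _ /Dx/esym/eqP].
  by rewrite (negPf (neq_lift _ _)).
have gi s i : g s (x (lift ord0 i)) = c (s i).
  rewrite gE indicE; case si : (s i).
    rewrite mem_set ?mulr1 ?subrKC//.
    by exists i => //=; exact/Dx.
  rewrite memNset ?mulr0 ?addr0// => -[j sj /Dx/lift_inj ji].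
  by move: sj; rewrite /= ji si.
(* Positive constants complete [G] to [d] elements: they differ from every [g s]
   at [x ord0], where [g s] is nonpositive. *)
pose h j : {mfun X >-> R} := cst (b / j.+1%:R).
have hb j : 0 < b / j.+1%:R <= b.
  by rewrite divr_gt0//= ler_piMr ?(ltW b0)// invf_le1 ?ltr0n// ler1n.
pose S := codom g ++
  [seq h j | j <- iota 0 (d - 2 ^ k)].
have uS : uniq S.
  rewrite cat_uniq; apply/and3P; split.
  - apply/injectiveP => s t gst; apply/ffunP => i.
    have : g s (x (lift ord0 i)) = g t (x (lift ord0 i)) by rewrite gst.
    rewrite !gi; case: (s i) (t i) => -[]// => /eqP; first by rewrite (negPf c1).
    by rewrite eq_sym (negPf c1).
  - apply/hasPn => _ /mapP[j _ ->]; apply/codomP => -[s hg].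
    have : h j (x ord0) = g s (x ord0) by rewrite hg.
    by rewrite g0 /= => hE; have := hb j; rewrite hE ltNge c0.
  - rewrite map_inj_uniq ?iota_uniq// => i j.
    move=> hE; have : h i (x ord0) = h j (x ord0) by rewrite hE.
    move=> /= /(mulfI (lt0r_neq0 b0))/invr_inj/eqP.
    by rewrite eqr_nat eqSS => /eqP.
exists [fset f in S]%fset, g; split => //.
- rewrite card_fseq undup_id// size_cat size_codom size_map card_ffun card_bool.
  by rewrite card_ord size_iota subnKC.
- move=> f; rewrite !inE => /orP[/codomP[s ->]|/mapP[j _ ->]] a.
    rewrite gE indicE; case: (_ \in _) => /=.
      by rewrite mulr1 addrC subrK.
    by rewrite mulr0 addr0.
  by have /andP[h0 hb'] := hb j; rewrite /= gtr0_norm.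
- by move=> s; rewrite !inE codom_f.
Qed.

Lemma sum_option (R : nmodType) (I : finType) (F : option I -> R) :
  \sum_a F a = F None + \sum_i F (Some i).
Proof.
rewrite (bigD1 None)//=; congr (_ + _).
rewrite (reindex_omap Some id) => [|[]]//=.
by apply: eq_bigl => i; rewrite eqxx.
Qed.

Lemma bernoulli_expn (R : realDomainType) (x : R) (n : nat) :
  0 <= x <= 1 -> 1 - n%:R * x <= (1 - x) ^+ n.
Proof.
move=> /andP[x0 x1]; elim: n => [|n IHn]; first by rewrite mul0r subr0 expr0.
have n0 : 0 <= n%:R :> R by [].
rewrite exprS -natr1; apply: (@le_trans _ _ ((1 - x) * (1 - n%:R * x))).
  have : 0 <= n%:R * x * x by rewrite !mulr_ge0.
  lra.
by rewrite ler_wpM2l// subr_ge0.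
Qed.

(** * Excess risk under finitely supported laws *)

Section discrete_risk.
Context {R : realType} {disp : measure_display} {X : measurableType disp}.
Context (q : R) (I : finType) (p : I -> R) (a : I -> X * R).
Context (P : probability (X * R)%type R).
Hypothesis p0 : forall i, 0 <= p i.
Hypothesis PE : forall f : X * R -> \bar R, (forall z, 0%E <= f z)%E ->
  measurable_fun setT f -> (\int[P]_z f z = \sum_i (p i)%:E * f (a i))%E.

Definition sample_risk (f : X -> R) : R :=
  \sum_i p i * `|(a i).2 - f (a i).1| `^ q.

Lemma sample_risk_ge0 f : 0 <= sample_risk f.
Proof. by apply: sumr_ge0 => i _; rewrite mulr_ge0 ?powR_ge0. Qed.

Lemma risk_discrete (f : X -> R) : measurable_fun setT f ->
  risk (power_loss q) P f = (sample_risk f)%:E.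
Proof.
move=> mf; rewrite /risk unlock PE.
- by rewrite sumEFin.
- by move=> z; rewrite lee_fin powR_ge0.
- apply/measurable_EFinP.
  apply: (measurableT_comp (measurable_powR q)).
  apply: (measurableT_comp (@normr_measurable R setT)).
  apply: measurable_funB; first exact: measurable_snd.
  by apply: (measurableT_comp mf); exact: measurable_fst.
Qed.

Lemma moment_discrete (s : R) :
  ('E_P[fun z => (`|z.2| `^ s)%R] = (\sum_i p i * `|(a i).2| `^ s)%R%:E)%E.
Proof.
rewrite unlock PE.
- by rewrite sumEFin.
- by move=> z; rewrite lee_fin powR_ge0.
- apply/measurable_EFinP.
  apply: (measurableT_comp (measurable_powR s)).
  by apply: (measurableT_comp (@normr_measurable R setT)); exact: measurable_snd.
Qed.

Lemma expected_risk_discrete (n : nat) (ghat : estimator R X n) :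
  expected_risk (power_loss q) P ghat =
  (\sum_(t : n.-tuple I) (\prod_(i <- t) p i) *
     sample_risk (fun x => ghat (map_tuple a t, x)))%:E.
Proof.
have mghat Z : measurable_fun setT (fun x => ghat (Z, x)).
  by apply: measurableT_comp => //; exact: measurable_pair1.
rewrite /expected_risk.
under eq_integral do rewrite risk_discrete//.
rewrite (integral_power_probability _ _ _ _ _ _ _ p0 PE).
- by rewrite -sumEFin.
- by move=> Z; rewrite lee_fin sample_risk_ge0.
- apply/measurable_EFinP; apply: measurable_sum => i.
  apply: measurable_funM => //.
  apply: (measurableT_comp (measurable_powR q)).
  apply: (measurableT_comp (@normr_measurable R setT)).
  apply: measurable_funB => //.
  by apply: measurableT_comp => //; exact: measurable_pair2.
Qed.

End discrete_risk.

(** Flipping one sign changes the law only at a point of mass [w / k], so the affinity of one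
    observation is at least [1 - w / k * h], and that of [n] observations at least 3 / 4 by
    Bernoulli. The excess risk is a sum over the points, as Assouad's lemma requires. *)
Lemma hypercube_lower_bound (R : realType) (q s A h D w : R)
    (Q : bool -> bool -> R) (v c : bool -> R) (k n : nat)
    (disp : measure_display) (X : measurableType disp) (x : 'I_k.+1 -> X)
    (g : {ffun 'I_k -> bool} -> {mfun X >-> R}) (ghat : estimator R X n) :
  1 < q -> hard_labels q Q v c h D -> 0 <= D -> 0 <= h -> 0 <= w <= 1 ->
  (0 < k)%N -> (0 < n)%N -> n%:R * (w / k%:R * h) <= 4^-1 ->
  (forall b, w * (\sum_e Q b e * `|v e| `^ s) + `|c false| `^ s <= A) ->
  (forall r, g r (x ord0) = c false) ->
  (forall r i, g r (x (lift ord0 i)) = c (r i)) ->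
  exists (r : {ffun 'I_k -> bool}) (P : probability (X * R)%type R),
    ('E_P[fun z => (`|z.2| `^ s)%R] <= A%:E)%E /\
    ((w * D / 8)%:E <= expected_risk (power_loss q) P ghat
       - risk (power_loss q) P (g r))%E.
Proof.
move=> q1 [Q0 Q1 Qmin Qexc Qaff] D0 h0 /andP[w0 w1] k0 n0 nwh momA g0 gi.
have kR0 : 0 < k%:R :> R by rewrite ltr0n.
(* [None] indexes the spare point, whose label is always [c false], the value that every [g r]
   predicts there. *)
pose p (r : {ffun 'I_k -> bool}) (a : option ('I_k * bool)) : R :=
  if a is Some (i, e) then w / k%:R * Q (r i) e else 1 - w.
pose loc (a : option ('I_k * bool)) : X * R :=
  if a is Some (i, e) then (x (lift ord0 i), v e) else (x ord0, c false).
have wk0 : 0 <= w / k%:R by rewrite divr_ge0// ltW.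
have p0 r a : 0 <= p r a.
  by case: a => [[i e]|] /=; rewrite ?subr_ge0// mulr_ge0.
have sum_p F r : \sum_a p r a * F (loc a) = (1 - w) * F (x ord0, c false) +
    w / k%:R * \sum_i \sum_e Q (r i) e * F (x (lift ord0 i), v e).
  rewrite sum_option/= mulr_sumr; congr (_ + _).
  under [RHS]eq_bigr do rewrite mulr_sumr.
  by rewrite pair_big/=; apply: eq_bigr => -[i e] _; rewrite mulrA.
have p1 r : \sum_a p r a = 1.
  transitivity (\sum_a p r a * (fun=> 1) (loc a)).
    by apply: eq_bigr => a _; rewrite mulr1.
  rewrite (sum_p (fun=> 1)) mulr1.
  under [X in _ * X]eq_bigr do (under eq_bigr do rewrite mulr1; rewrite Q1).
  by rewrite sumr_const card_ord divfK ?gt_eqF// subrK.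
have affinity r i : 3 / 4 <= (\sum_a Num.sqrt (p r a * p (flip i r) a)) ^+ n.
  have wkh0 : 0 <= w / k%:R * h by rewrite mulr_ge0.
  have wkh1 : w / k%:R * h <= 4^-1.
    by apply: le_trans nwh; rewrite ler_peMl// ler1n.
  apply: (@le_trans _ _ ((1 - w / k%:R * h) ^+ n)).
    apply: le_trans (bernoulli_expn _ _ _ _); first by lra.
    by apply/andP; split => //; lra.
  apply: lerXn2r; rewrite ?nnegrE; first by lra.
    by apply: sumr_ge0 => a _; exact: sqrtr_ge0.
  rewrite sum_option -expr2 sqrtr_sqr ger0_norm ?subr_ge0//.
  have term j : w / k%:R * (1 - (j == i)%:R * h) <= \sum_e
      Num.sqrt (p r (Some (j, e)) * p (flip i r) (Some (j, e))).
    rewrite /= ffunE; have [->|_] := eqVneq j i.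
      rewrite mul1r.
      have -> : \sum_e Num.sqrt (w / k%:R * Q (r i) e * (w / k%:R * Q (~~ r i) e))
          = w / k%:R * \sum_e Num.sqrt (Q true e * Q false e).
        rewrite mulr_sumr; apply: eq_bigr => e _.
        rewrite mulrACA -expr2 sqrtrM ?sqr_ge0// sqrtr_sqr ger0_norm//.
        by case: (r i) => //=; rewrite [Q false _ * _]mulrC.
      by rewrite ler_wpM2l.
    rewrite mul0r subr0 -(Q1 (r j)) mulr_sumr; apply: ler_sum => e _.
    by rewrite -expr2 sqrtr_sqr ler_norm.
  rewrite (_ : \sum_(u : 'I_k * bool) _ = \sum_j \sum_e
      Num.sqrt (p r (Some (j, e)) * p (flip i r) (Some (j, e)))); last first.
    by rewrite pair_big; apply: eq_bigr => -[].
  apply: le_trans (lerD (lexx _) (ler_sum _ (fun j _ => term j))).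
  rewrite -mulr_sumr sumrB sumr_const card_ord -mulr_suml.
  rewrite (bigD1 i)//= eqxx big1 => [|j /negPf->//].
  by rewrite addr0 mul1r mulrBr divfK ?gt_eqF//; lra.
pose l b y := label_risk q Q v b y.
pose e b i (t : n.-tuple (option ('I_k * bool))) :=
  l b (ghat (map_tuple loc t, x (lift ord0 i))) - l b (c b).
have e0 b i t : 0 <= e b i t by rewrite subr_ge0; exact: Qmin.
have eD i t : D <= e true i t + e false i t.
  by have := Qexc (ghat (map_tuple loc t, x (lift ord0 i))); rewrite /e /l; lra.
have [r Hr] := assouad R _ n k p e D p0 p1 affinity D0 e0 eD.
have [P PE] := discrete_probability R _ (X * R)%type _ _ loc (p0 r) (p1 r).
exists r, P; split.
  rewrite (moment_discrete _ _ _ _ PE) lee_fin.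
  rewrite (sum_p (fun z => `|z.2| `^ s))/= mulr_sumr.
  have le_i i : w / k%:R * (\sum_e Q (r i) e * `|v e| `^ s) <=
      (A - `|c false| `^ s) / k%:R.
    rewrite mulrAC ler_wpM2r ?invr_ge0 ?ler0n// lerBrDr; exact: momA.
  apply: le_trans (lerD (lexx _) (ler_sum _ (fun i _ => le_i i))) _.
  rewrite sumr_const card_ord -[X in _ + X]mulr_natr divfK ?gt_eqF//.
  have := powR_ge0 `|c false| s; nra.
rewrite (expected_risk_discrete _ _ _ _ _ (p0 r) PE).
rewrite (risk_discrete _ _ _ _ _ PE)// -EFinB lee_fin.
have srE f : sample_risk q _ (p r) loc f = (1 - w) * `|c false - f (x ord0)| `^ q
    + w / k%:R * \sum_i l (r i) (f (x (lift ord0 i))).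
  exact: (sum_p (fun z => `|z.2 - f z.1| `^ q)).
have srg : sample_risk q _ (p r) loc (g r) = w / k%:R * \sum_i l (r i) (c (r i)).
  rewrite srE g0 subrr normr0 powR0 ?mulr0 ?add0r; last by rewrite gt_eqF; lra.
  by under eq_bigr do rewrite gi.
have sum1 : \sum_(t : n.-tuple (option ('I_k * bool))) \prod_(a <- t) p r a = 1.
  by rewrite sum_tuple_prod p1 expr1n.
(* The sample weights sum to one, so the risk of [g r] is subtracted inside the sum. The loss of the
   estimator at the spare point is nonnegative and is dropped at the end. *)
rewrite -[X in _ - X]mul1r -[X in _ - X * _]sum1 mulr_suml -sumrB.
apply: (@le_trans _ _ (w / k%:R * (D * k%:R / 8))).
  by rewrite le_eqVlt; apply/orP; left; apply/eqP; field; rewrite gt_eqF.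
apply: le_trans (ler_wpM2l wk0 Hr) _; rewrite mulr_sumr; apply: ler_sum => t _.
rewrite -mulrBr mulrCA ler_wpM2l ?prodr_ge0// srg srE -addrA -mulrBr -sumrB.
by rewrite lerDr mulr_ge0 ?powR_ge0 ?subr_ge0.
Qed.

(** * Rates *)

(* [t] stands for [min (ln d / n) 1] and [w] is the mass of the hypercube. *)
Definition attainable_rate {R : realType} (q s b A alpha : R) : Prop :=
  exists (C : R) (c : bool -> R),
  [/\ 0 < C, forall e, `|c e| <= b, c false <= 0, c true != c false &
  forall t, 0 < t <= 1 -> exists Q v h D w,
    [/\ hard_labels q Q v c h D, 0 <= D, 0 <= h, 0 <= w <= 1 &
    [/\ w * h <= t / 8,
        forall e, w * (\sum_y Q e y * `|v y| `^ s) + `|c false| `^ s <= A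
      & C * t `^ alpha <= w * D / 8]]].

(** Here [D] is constant and [h = p] is at most of order [B ^ (1 - q)]. The constraints
    [w * p <= t / 8] and [w * p * B ^ s <= A] meet at [B ^ s = 1 / t], which allows [w] of order
    [t * B ^ (q - 1)]. *)
Lemma attainable_rare (R : realType) (q s b A : R) :
  1 < q -> q <= s -> 0 < b -> 0 < A ->
  attainable_rate q s b A (1 - (q - 1) / s).
Proof.
move=> q1 qs b0 A0.
have s0 : 0 < s by lra.
pose e := Num.min b 2^-1.
have e0 : 0 < e by rewrite lt_min b0 invr_gt0 ltr0n.
have eb : e <= b by rewrite ge_min lexx.
have e2 : e <= 2^-1 by rewrite ge_min lexx orbT.
(* The bound 1 / 8 serves [w * h <= t / 8], the bound [A] serves the moment. *)
pose w0 := Num.min 8^-1 A.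
have w00 : 0 < w0 by rewrite lt_min A0 invr_gt0 ltr0n.
have w08 : w0 <= 8^-1 by rewrite ge_min lexx.
have w0A : w0 <= A by rewrite ge_min lexx orbT.
pose D := e `^ q / 2 * ((q - 1) * (1 - 2^-1 `^ (q - 1)^-1)).
have D0 : 0 < D.
  rewrite /D mulr_gt0 ?divr_gt0 ?powR_gt0//.
  rewrite mulr_gt0 ?subr_gt0//.
  have : 2^-1 `^ (q - 1)^-1 < 1 `^ (q - 1)^-1 :> R.
    by apply: gt0_ltr_powR; rewrite ?invr_gt0 ?nnegrE; lra.
  by rewrite powR1.
exists (w0 * D / 8), (fun e' => if e' then e else 0); split.
- by apply: divr_gt0 => //; exact: mulr_gt0.
- by case; [rewrite gtr0_norm|rewrite normr0 ltW].
- by [].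
- by rewrite gt_eqF.
move=> t /andP[t0 t1].
pose B := t `^ (- s^-1).
have B0 : 0 < B by exact: powR_gt0.
have B1 : 1 <= B.
  rewrite -[leLHS](powRr0 t) /B; apply: ger_powR; first by rewrite t0.
  by rewrite oppr_le0 invr_ge0 ltW.
pose p := e `^ (q - 1) / ((B - e) `^ (q - 1) + e `^ (q - 1)).
pose w := w0 * t `^ (1 - (q - 1) / s).
have hard := rare_labels _ _ _ _ p q1 e0 e2 B1 erefl.
have p0 : 0 <= p by rewrite divr_ge0 ?addr_ge0 ?powR_ge0.
have w_ge0 : 0 <= w by rewrite mulr_ge0 ?powR_ge0 ?ltW.
have wp : w * p <= w0 * t.
  have := ler_wpM2l w_ge0 (rare_labels_prob _ _ _ _ q1 e0 e2 B1).
  move/le_trans; apply.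
  rewrite /w /B -powRrM -mulrA -powRD; last by rewrite (gt_eqF t0) implybT.
  rewrite (_ : 1 - (q - 1) / s + - s^-1 * (1 - q) = 1).
    by rewrite powRr1// ltW.
  by field; rewrite gt_eqF.
exists (fun b y => if b then if y then p else 1 - p else if y then 0 else 1).
exists (fun y => if y then B else 0), p, D, w; split => //.
- exact: ltW.
- rewrite w_ge0/= (le_trans _ (_ : w0 <= 1))//; last by lra.
  rewrite /w ler_piMr ?(ltW w00)// -[leRHS](powRr0 t); apply: ger_powR.
    by rewrite t0.
  by rewrite subr_ge0 ler_pdivrMr//; lra.
- split.
  + by apply: le_trans wp _; rewrite mulrC ler_pM2l.
  + move=> []; rewrite big_bool/= normr0 powR0 ?gt_eqF//
      ?mulr0 ?mul0r ?addr0; last first.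
      by rewrite mulr0 ltW.
    rewrite (gtr0_norm B0) mulrA.
    apply: le_trans (ler_wpM2r (powR_ge0 _ _) wp) _.
    rewrite /B -powRrM mulNr mulVf ?gt_eqF// -mulrA powR_inv1 ?(ltW t0)//.
    by rewrite mulfV ?gt_eqF// mulr1.
  + by rewrite /w le_eqVlt; apply/orP; left; apply/eqP; ring.
Qed.

(** The moment allows [w] of order [B ^ (- s)]. As [h] is of order [B ^ (- 2)], [w * h] matches
    [t = B ^ (- (s + 2))]; and [D] of order [B ^ (q - 2)] makes [w * D] of order [t * B ^ q]. *)
Lemma attainable_balanced (R : realType) (q s b A : R) :
  1 < q -> q <= s -> 0 < b -> 0 < A ->
  attainable_rate q s b A (1 - q / (s + 2)).
Proof.
move=> q1 qs b0 A0.
have s0 : 0 < s by lra.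
have s20 : 0 < s + 2 by lra.
(* Half of [A] is kept for the label at the spare point, the other half, through [w0], for the
   labels [B] and [- B]. The bound 1 / 2 gives [c < B] and [2 * c <= 1]. *)
pose c := Num.min (Num.min b 2^-1) ((A / 2) `^ s^-1).
have A20 : 0 < A / 2 by lra.
have c0 : 0 < c by rewrite !lt_min b0 invr_gt0 ltr0n powR_gt0.
have cb : c <= b by rewrite !ge_min lexx.
have c2 : c <= 2^-1 by rewrite !ge_min lexx orbT.
have cA : c `^ s <= A / 2.
  have /(ge0_ler_powR (ltW s0)) : c <= (A / 2) `^ s^-1 by rewrite ge_min lexx orbT.
  rewrite -powRrM mulVf ?gt_eqF// powRr1 ?(ltW A20)//.
  apply; rewrite nnegrE ?powR_ge0//.
  exact: ltW.
pose K := Num.max 1 (q - 1).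
have K1 : 1 <= K by rewrite le_max lexx.
have K0 : 0 < K by lra.
(* Below, [w * h] equals [w0 * K ^+ 2 * (2 * c) ^+ 2 * t], so the second bound makes it at most
   [t / 8]. *)
pose w0 := Num.min (A / 2) (8 * K ^+ 2)^-1.
have K8 : 0 < 8 * K ^+ 2 by rewrite mulr_gt0 ?exprn_gt0.
have w00 : 0 < w0 by rewrite lt_min A20 invr_gt0.
have w0A : w0 <= A / 2 by rewrite ge_min lexx.
have w0K : w0 * (8 * K ^+ 2) <= 1.
  by rewrite -ler_pdivlMr// div1r ge_min lexx orbT.
have K21 : 1 <= K ^+ 2 by rewrite exprn_ege1.
have w01 : w0 <= 1 by nra.
pose k := Num.min 1 ((q - 1) / 2).
have k0 : 0 < k by rewrite lt_min ltr01; lra.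
exists (w0 * k * c ^+ 2 / 4), (fun e => if e then c else - c); split.
- by apply: divr_gt0 => //; rewrite !mulr_gt0 ?exprn_gt0.
- by case; rewrite ?normrN gtr0_norm.
- lra.
- by apply/eqP; lra.
move=> t /andP[t0 t1].
pose u := t `^ (s + 2)^-1.
have u0 : 0 < u by exact: powR_gt0.
have u1 : u <= 1.
  by rewrite -[leRHS](powRr0 t) /u; apply: ger_powR; rewrite ?t0// invr_ge0 ltW.
have uE x : t `^ (x / (s + 2)) = u `^ x by rewrite mulrC powRrM.
pose B := u^-1.
have B0 : 0 < B by rewrite invr_gt0.
have B1 : 1 <= B by rewrite invf_ge1.
have cB : c < B by lra.
have := balanced_labels _ _ _ _ q1 c0 cB.
set a := (B + c) `^ (q - 1); set a' := (B - c) `^ (q - 1) => hard.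
have a0 : 0 < a by rewrite powR_gt0//; lra.
have a'0 : 0 < a' by rewrite powR_gt0//; lra.
pose w := w0 * u `^ s.
have us1 : u `^ s <= 1.
  by rewrite -[leRHS](powRr0 u); apply: ger_powR; rewrite ?u0// ltW.
have w_ge0 : 0 <= w by rewrite mulr_ge0 ?powR_ge0 ?ltW.
have tE : t = u `^ s * u ^+ 2.
  rewrite -powR_mulrn ?(ltW u0)// -powRD; last by rewrite (gt_eqF u0) implybT.
  by rewrite -uE divff ?gt_eqF// powRr1// ltW.
exists (fun b y => (if b == y then a else a') / (a + a')).
exists (fun y => if y then B else - B).
exists ((K * (2 * c / B)) ^+ 2), (2 * (B `^ q * (k * (c / B) ^+ 2))), w.
split => //.
- by rewrite mulr_ge0// mulr_ge0 ?powR_ge0// mulr_ge0 ?sqr_ge0// ltW.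
- exact: sqr_ge0.
- by rewrite w_ge0/= /w mulr_ile1 ?powR_ge0// ltW.
- split.
  + rewrite tE /w /B invrK.
    have c21 : (2 * c) ^+ 2 <= 1 by rewrite expr_le1//; lra.
    have : u `^ s * u ^+ 2 * (w0 * K ^+ 2 * (2 * c) ^+ 2) <= u `^ s * u ^+ 2 * 8^-1.
      rewrite ler_wpM2l ?mulr_ge0 ?powR_ge0 ?sqr_ge0//.
      have : w0 * K ^+ 2 * (2 * c) ^+ 2 <= w0 * K ^+ 2.
        by rewrite ler_piMr// mulr_ge0 ?sqr_ge0// ltW.
      lra.
    by apply: le_trans; rewrite le_eqVlt; apply/orP; left; apply/eqP; ring.
  + move=> e; rewrite big_bool/= !normrN (gtr0_norm B0) (gtr0_norm c0).
    have -> : (if e == true then a else a') / (a + a') * B `^ s +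
        (if e == false then a else a') / (a + a') * B `^ s = B `^ s.
      by case: e => /=; field; rewrite gt_eqF//; lra.
    have -> : w * B `^ s = w0.
      rewrite /w -mulrA -powRM ?(ltW u0) ?(ltW B0)//.
      by rewrite /B divff ?gt_eqF// powR1 mulr1.
    lra.
  + have -> : t `^ (1 - q / (s + 2)) = u `^ s * u ^+ 2 / u `^ q.
      rewrite powRB; last by rewrite (gt_eqF t0) implybT.
      by rewrite uE powRr1 ?(ltW t0)// -tE.
    rewrite /B -(powR_inv1 (ltW u0)) -powRrM mulN1r powRN powR_inv1 ?(ltW u0)//.
    rewrite invrK /w.
    by rewrite le_eqVlt; apply/orP; left; apply/eqP; field; rewrite gt_eqF ?powR_gt0.
Qed.

(** * From an attainable rate to the theorem *)

Lemma ln_nat_le (R : realType) (d k : nat) : (0 < d)%N -> (0 < k)%N ->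
  (d < 2 ^ k.+1)%N -> ln d%:R <= 2 * k%:R :> R.
Proof.
move=> d0 k0 dk.
have : ln d%:R <= ln (2 ^+ k.+1) :> R.
  by rewrite ler_ln ?posrE ?ltr0n ?exprn_gt0// -natrX ler_nat ltnW.
rewrite lnXn// -mulr_natr -natr1.
have ln2 : ln 2 <= 1 :> R.
  by have := @le_ln1Dx R 1; rewrite -natr1; apply; lra.
have k1 : 1 <= k%:R :> R by rewrite ler1n.
nra.
Qed.

Lemma excess_le_min (R : realType) (disp : measure_display)
    (X : measurableType disp) (q L : R) (P : probability (X * R)%type R)
    (G : {fset {mfun X >-> R}}) (f : {mfun X >-> R}) (E : \bar R) : f \in G ->
  (L%:E <= E - risk (power_loss q) P f ->
   L%:E <= E - min_risk (power_loss q) P G)%E.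
Proof.
move=> fG /le_trans; apply; apply: leeB => //.
exact: (bigmin_inf_seq _ f).
Qed.

(** Under the point mass at [(a, 0)] the zero predictor has no risk, and risks are nonnegative. This
    settles the class with one element. *)
Lemma zero_excess (R : realType) (disp : measure_display)
    (X : measurableType disp) (a : X) (q s : R) (n : nat)
    (ghat : estimator R X n) : 0 < q -> 0 < s ->
  exists P : probability (X * R)%type R,
    ('E_P[fun z => (`|z.2| `^ s)%R] = 0)%E /\
    (0 <= expected_risk (power_loss q) P ghat
          - risk (power_loss q) P (@cst X R 0%R))%E.
Proof.
move=> q0 s0.
have p0 (i : unit) : 0 <= (fun=> 1 : R) i by [].
have p1 : \sum_(i : unit) (fun=> 1 : R) i = 1 by rewrite sumr_const card_unit.
have [P PE] := discrete_probability R _ (X * R)%type _ _ (fun=> (a, 0)) p0 p1.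
exists P; split.
  rewrite (moment_discrete _ _ _ _ PE)/= big1// => _ _.
  by rewrite normr0 powR0 ?mulr0// gt_eqF.
rewrite (risk_discrete _ _ _ _ _ PE)// /sample_risk big1 => [|i _]; last first.
  by rewrite /= subrr normr0 powR0 ?mulr0// gt_eqF.
rewrite sube0; apply: integral_ge0 => Z _.
by rewrite /risk; apply: expectation_ge0 => z; exact: powR_ge0.
Qed.

Theorem theorem8p14 (R : realType) (q s b A : R)
    (hq : 1 < q) (hqs : q <= s) (hb : 0 < b) (hA : 0 < A) :
  exists C : R, 0 < C /\
  forall (d n : nat) (disp : measure_display) (X : measurableType disp)
    (x : 'I_(trunc_log 2 (2 * d)) -> X),
    (1 <= d)%N -> (1 <= n)%N -> measurably_separated x ->
  exists G : {fset {mfun X >-> R}},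
    #|` G|%fset = d /\
    (forall g, g \in G -> forall a : X, `|g a| <= b) /\
    forall ghat : estimator R X n,
    exists P : probability (X * R)%type R,
      ('E_P[fun z => (`|z.2| `^ s)%R] <= A%:E)%E /\
      ((C * (Num.min (ln #|` G|%fset%:R / n%:R) 1) `^ (1 - (q - 1) / s))%:E
        <= expected_risk (power_loss q) P ghat
           - min_risk (power_loss q) P G)%E /\
      ((C * (Num.min (ln #|` G|%fset%:R / n%:R) 1) `^ (1 - q / (s + 2)))%:E
        <= expected_risk (power_loss q) P ghat
           - min_risk (power_loss q) P G)%E.
Proof.
have q0 : 0 < q by lra.
have s0 : 0 < s by lra.
have s20 : 0 < s + 2 by lra.
pose alpha1 := 1 - (q - 1) / s.
pose alpha2 := 1 - q / (s + 2).
have alpha1_gt0 : 0 < alpha1 by rewrite subr_gt0 ltr_pdivrMr//; lra.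
have alpha2_gt0 : 0 < alpha2 by rewrite subr_gt0 ltr_pdivrMr//; lra.
have [alpha [[C [c [C0 cb c0 c1 labels]]] le1 le2]] : exists alpha : R,
    [/\ attainable_rate q s b A alpha, alpha <= alpha1 & alpha <= alpha2].
  have [le12|/ltW le21] := leP alpha1 alpha2.
    by exists alpha1; split => //; exact: attainable_rare.
  by exists alpha2; split => //; exact: attainable_balanced.
exists C; split => // d n disp X x d0 n0 sepx.
have [d1|d1] := leqP d 1.
  have {d0 d1} d1 : d = 1%N by apply/eqP; rewrite eqn_leq d1.
  subst d.
  exists [fset (cst 0 : {mfun X >-> R})]%fset; split; first exact: cardfs1.
  split=> [g|ghat]; first by rewrite inE => /eqP -> a; rewrite /= normr0 ltW.
  have x0 : 'I_(trunc_log 2 (2 * 1)) by rewrite muln1 trunc_lognn//; exact: ord0.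
  have [P [EP risk0]] := zero_excess R _ X (x x0) _ _ _ ghat q0 s0.
  exists P; rewrite EP lee_fin ltW//; split=> //.
  (* For [d = 1] the logarithm vanishes, and so does each rate because its exponent is positive:
     [powR] of 0 at exponent 0 would be 1. *)
  rewrite cardfs1 ln1 mul0r min_l// !powR0 ?gt_eqF// mulr0.
  by split; apply: excess_le_min risk0; rewrite inE.
pose k := trunc_log 2 d.
have k0 : (0 < k)%N by rewrite trunc_log_gt0.
(* The factor 2 in the number of points pays for the spare point. *)
have kE : trunc_log 2 (2 * d) = k.+1 by rewrite trunc_logMp.
move: x sepx; rewrite kE => x sepx.
have [G [g [Gd Gb gG g0 gi]]] :=
  hypercube_class _ _ d _ _ _ _ _ sepx (trunc_logP (isT : (1 < 2)%N) d0) hb cb c0 c1.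
exists G; rewrite Gd; split=> //; split=> // ghat.
set t := Num.min _ _.
have nR0 : 0 < n%:R :> R by rewrite ltr0n.
have kR0 : 0 < k%:R :> R by rewrite ltr0n.
have t0 : 0 < t by rewrite lt_min divr_gt0 ?ln_gt0 ?ltr1n//= ltr01.
have t1 : t <= 1 by rewrite ge_min lexx orbT.
have tn : n%:R * t <= 2 * k%:R.
  have : t <= ln d%:R / n%:R by rewrite ge_min lexx.
  rewrite ler_pdivlMr// mulrC => /le_trans; apply.
  by apply: ln_nat_le => //; exact: trunc_log_ltn.
have t01 : 0 < t <= 1 by rewrite t0.
have [Q [v [h [D [w [hard D0 h0 w01 [wh mom rate]]]]]]] := labels t t01.
(* From [w * h <= t / 8] and [n * t <= 2 * k]: this is what the 8 in [attainable_rate] is for. *)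
have nwh : n%:R * (w / k%:R * h) <= 4^-1.
  rewrite (_ : _ * _ = n%:R * (w * h) / k%:R); last by ring.
  by rewrite ler_pdivrMr//; have := ler_wpM2l (ltW nR0) wh; lra.
have [r [P [EP excess]]] := hypercube_lower_bound R q s A h D w Q v c k n _ X x
  g ghat hq hard D0 h0 w01 k0 n0 nwh mom g0 gi.
have le_excess beta : alpha <= beta ->
    ((C * t `^ beta)%:E <= expected_risk (power_loss q) P ghat
      - min_risk (power_loss q) P G)%E.
  move=> le_beta; apply: excess_le_min (gG r) _.
  apply: le_trans excess; rewrite lee_fin; apply: le_trans rate.
  by rewrite ler_wpM2l ?(ltW C0)//; apply: ger_powR.
by exists P; split=> //; split; exact: le_excess.
Qed.
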